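(* In the geometric amoebot model with reconfigurable circuits, there is a protocol by which a connected amoebot structure can detect a parallelogram with arbitrary side ratio, i.e. decide whether it forms a parallelogram. A constant number of rounds is required.
   Context: Parallelograms. $G_{eqt}=(V,E)$ is the infinite regular triangular grid graph. Parallelograms $\mathcal P$ considered have their corners at nodes of $G_{eqt}$ and their sides parallel to grid axes; degenerate parallelograms (a single node, or a straight line segment along an axis) are included. An amoebot structure $S\subseteq V$ forms $\mathcal P$ iff $\mathcal P\cap V=S$. Amoebot model with circuits. A set of $n$ amoebots occupies a finite set $S\subseteq V$ of nodes, $|S|=n$, exactly one amoebot per node of $S$; the induced graph $G_S=G_{eqt}|_S$ is connected; amoebots do not move. Amoebots on adjacent nodes are neighbors and are joined by a bond. All amoebots are anonymous and run the same randomized finite state machine (constant memory, independent of $n$). Each amoebot knows which of its six adjacent nodes are occupied and assigns locally unique labels to its incident edges; amoebots need not agree on a compass orientation nor on a chirality. Every edge incident to an amoebot carries the same constant number of pins (for this lemma any number $\ge 1$) in a fixed linear order; the pins on a bond are shared by the two neighbors. Each amoebot chooses a pin configuration: an arbitrary set of undirected wires between pins on its own incident edges. If $P$ is the set of all pins and $C$ the set of all wires, a circuit is a connected component of the graph $(P,C)$; an amoebot is part of a circuit iff the circuit contains a pin on one of its bonds. Time proceeds in synchronous rounds; in each round every amoebot reads its memory and the beeps received on its circuits, computes and updates its memory, and then may reconfigure its wires and send a beep on any of its circuits. A beep sent on a circuit is received in the next round by all amoebots of that circuit; an amoebot only learns whether at least one beep was sent on the circuit, not the origin nor the number of senders. Running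 time is the number of rounds. *)

(* Defs.v *)
From mathcomp Require Import classical_sets reals.
From mathcomp Require Import all_boot all_order all_algebra finmap.

Set Implicit Arguments.
Unset Strict Implicit.
Unset Printing Implicit Defensive.

Import Order.TTheory GRing.Theory Num.Theory.
Local Open Scope ring_scope.

(** ** The triangular grid *)

(* The node (x, y) stands for x e0 + y e1, where e0, e1 are unit vectors at an
   angle of 60 degrees (see [embed]). *)
Definition node : Type := (int * int)%type.

(* The six grid directions in counterclockwise order; [d + 3] (addition modulo
   6) is opposite to [d]. *)
Definition unit_vec (d : 'I_6) : node :=
  nth 0 [:: (1, 0); (0, 1); (-1, 1); (-1, 0); (0, -1); (1, -1)] d.

Definition adjacent : rel node := fun u v => [exists d, v == u + unit_vec d].

Definition connected_structure (S : {fset node}) : Prop :=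
  forall u v : S, connect (fun x y : S => adjacent (val x) (val y)) u v.

(** ** Parallelograms *)

Definition embed (R : realType) (v : node) : 'rV[R]_2 :=
  \row_(i < 2) [:: v.1%:~R + v.2%:~R / 2; Num.sqrt 3 / 2 * v.2%:~R]`_i.

(* The region of the plane with corner [p] and sides of lengths [m] and [n] in
   the directions [d] and [e]. *)
Definition parallelogram (R : realType) (p : node) (d e : 'I_6) (m n : nat) :
    set 'rV[R]_2 :=
  [set x | exists s t : R, [/\ 0 <= s <= m%:R, 0 <= t <= n%:R &
    x = embed R p + s *: embed R (unit_vec d) + t *: embed R (unit_vec e)]]%classic.

(* [m] and [n] may be 0: segments and single nodes are included. *)
Definition forms_parallelogram (R : realType) (S : {fset node}) : Prop :=
  exists (p : node) (d e : 'I_6) (m n : nat),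
    [/\ e != d, e != d + 3 &
      (@parallelogram R p d e m n `&` range (embed R) =
       embed R @` [set` S])%classic].

(** ** Pins *)

(* A pin of an undirected edge (the set of its two endpoints), given by its
   position in the linear order of that edge. *)
Definition pin (k : nat) : Type := ({fset node} * 'I_k)%type.

(* A pin as an amoebot refers to it: label of the incident edge, position. *)
Notation lpin k := ('I_6 * 'I_k)%type.

(** ** Protocols *)

(* The finite state machine run by every amoebot.  In each round it tosses
   [nflips] fair coins, and [step occ m r w] gives the new memory, the wires
   and the pins to beep on, where [occ] are the labels of the edges leading to
   occupied nodes, [m] is the memory, [r] the set of pins on whose circuit a
   beep was received, and [w] the outcome of the coin tosses. *)
Record protocol (k : nat) := Protocol {
  memory : finType;
  nflips : nat;
  start : memory;
  step : {set 'I_6} -> memory -> {set lpin k} -> nflips.-tuple bool ->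
         memory * {set lpin k * lpin k} * {set lpin k};
  decision : memory -> option bool }.

(** ** Executions *)

Record amoebot_state (k : nat) (A : protocol k) := AmoebotState {
  memo : memory A;
  wires : {set lpin k * lpin k};
  beeps : {set lpin k} }.

Section Execution.

Variables (k : nat) (A : protocol k) (S : {fset node}).

(* Compass orientation and chirality of each amoebot: the edge with label 0
   points in direction [compass a], and labels increase counterclockwise iff
   [chirality a]. *)
Variables (compass : S -> 'I_6) (chirality : S -> bool).

Definition config : Type := S -> amoebot_state A.

Definition dir_of_label (a : S) (l : 'I_6) : 'I_6 :=
  if chirality a then compass a + l else compass a - l.

Definition neighbor_node (a : S) (l : 'I_6) : node :=
  val a + unit_vec (dir_of_label a l).

Definition occupied (a : S) : {set 'I_6} := [set l | neighbor_node a l \in S].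

Definition pin_at (a : S) (x : lpin k) : pin k :=
  ([fset val a; neighbor_node a x.1]%fset, x.2).

Definition on_bond (a : S) (x : lpin k) : bool := x.1 \in occupied a.

Definition pins : {fset pin k} :=
  [fset pin_at a x | a in {: S}, x in {: lpin k}]%fset.

Definition wired (c : config) : rel pins := fun p q =>
  [exists a : S, exists w in wires (c a),
    ((val p == pin_at a w.1) && (val q == pin_at a w.2)) ||
    ((val q == pin_at a w.1) && (val p == pin_at a w.2))].

Definition same_circuit (c : config) : rel pins := connect (wired c).

Definition beeping (c : config) (q : pins) : bool :=
  [exists b : S, exists y in beeps (c b),
    on_bond b y && (val q == pin_at b y)].

Definition received (c : config) (a : S) : {set lpin k} :=
  [set x | on_bond a x &&
    [exists p : pins, exists q : pins,
      [&& val p == pin_at a x, same_circuit c p q & beeping c q]]].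

Definition init_config : config := fun=> AmoebotState (start A) set0 set0.

Definition next_config (w : S -> (nflips A).-tuple bool) (c : config) : config :=
  fun a =>
    let: (m, ws, bs) := step (occupied a) (memo (c a)) (received c a) (w a) in
    AmoebotState m ws bs.

(* The configuration after [t] rounds, when [flips i a] are the coin tosses of
   [a] in round [i]. *)
Fixpoint run (flips : nat -> S -> (nflips A).-tuple bool) (t : nat) : config :=
  if t is t'.+1 then next_config (flips t') (run flips t') else init_config.

End Execution.

(* Within [T] rounds every amoebot decides the property [P] of structures: from
   round [T] on it has an output, and no output is ever wrong.  As [T] does not
   depend on the coin tosses, holding with probability 1 is the same as holding
   for every outcome of the tosses. *)
Definition decides_within (k : nat) (A : protocol k) (T : nat)
    (P : {fset node} -> Prop) : Prop :=
  forall S : {fset node}, connected_structure S ->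
  forall (compass : S -> 'I_6) (chirality : S -> bool)
         (flips : nat -> S -> (nflips A).-tuple bool) (a : S) (t : nat),
    let out := decision (memo (run compass chirality flips t a)) in
    ((T <= t)%N -> out != None) /\
    (forall b : bool, out = Some b -> (b <-> P S)).

(* Main.v *)
Require Import Defs.
From mathcomp Require Import classical_sets reals.
From mathcomp Require Import all_boot all_order all_algebra finmap.
From mathcomp Require Import boolp zify ring lra.

(* S is a parallelogram without sides along the axis f iff S is connected and, at
   every node v of S, the node v + f is occupied exactly when v + x and v + y are,
   where x and y are the unit vectors with f = x + y, and likewise for -f.  This
   is a test on the neighborhood of v, but f has to be the same for all nodes,
   which share no compass.  Nodes for which some f works are interior nodes, nodes
   inside a side, corners of 60 or 120 degrees, or nodes of a segment.  In a
   parallelogram each side joins a 60 degree corner to a 120 degree corner, which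
   then determine the same f.  So in two rounds in which the straight lines are
   circuits, the corners of either kind beep and those of the other kind check that
   they hear a beep along both their sides; a last round broadcasts failures on a
   circuit joining all pins.

   Conversely let all tests succeed.  A node minimizing a suitable linear form is
   the end of a segment, which is then all of S, or a corner, so that there is a
   60 degree corner.  Walking from it along its two sides, and from their 120
   degree ends along the other two, gives four sides; filling up the rows between
   them shows that the last two meet, and connectedness excludes further nodes. *)

Set Implicit Arguments.
Unset Strict Implicit.
Unset Printing Implicit Defensive.

Import Order.TTheory GRing.Theory Num.Theory.
Local Open Scope ring_scope.

(** * Occupancy patterns of the six neighbors of a node *)

Definition directions : seq 'I_6 := [:: 0; 1; 2; 3; 4; 5].

(* [o l] tells whether the neighbor in direction (or with label) [l] is
   occupied; [f] is the axis of the short diagonals of the unit rhombi. *)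
Definition good_axis (o : 'I_6 -> bool) (f : 'I_6) : bool :=
  (o f == o (f + 1) && o (f - 1)) && (o (f + 3) == o (f + 2) && o (f - 2)).

Definition fine (o : 'I_6 -> bool) : bool := has (good_axis o) directions.

(** A 60 degree corner with sides in directions [l] and [l + 1]. *)
Definition acute_at (o : 'I_6 -> bool) (l : 'I_6) : bool :=
  [&& o l, o (l + 1) & ~~ has o [:: l + 2; l + 3; l + 4; l + 5]].

Definition acute (o : 'I_6 -> bool) : bool := has (acute_at o) directions.

(** A 120 degree corner; [l] is its bisecting direction. *)
Definition obtuse (o : 'I_6 -> bool) : bool :=
  has (fun l => [&& o (l - 1), o l, o (l + 1) &
                    ~~ has o [:: l + 2; l + 3; l + 4]]) directions.

(** At a corner these are exactly its two side directions: the bisecting neighbor of a 120 degree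
    corner is flanked on both sides. *)
Definition boundary (o : 'I_6 -> bool) (l : 'I_6) : bool :=
  o l && ~~ (o (l + 1) && o (l - 1)).

(* Direction of label [k] for compass [c] and chirality [b]; such frames also
   serve as coordinate systems rotated and reflected at will. *)
Definition frame (c : 'I_6) (b : bool) (k : 'I_6) : 'I_6 :=
  if b then c + k else c - k.

(** Turns a pattern into six bits, so that facts about patterns are checked by evaluating 64
    cases. *)
Lemma pattern_bits (o : 'I_6 -> bool) :
  o = fun k : 'I_6 => nth false [:: o 0; o 1; o 2; o 3; o 4; o 5] k.
Proof.
apply: funext => k.
by case: k => [[|[|[|[|[|[|//]]]]]] ik] /=; congr o; apply: val_inj.
Qed.

Ltac case_ord k := case: k => [[|[|[|[|[|[|//]]]]]] ?].
Ltac case_pattern o :=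
  rewrite (pattern_bits o);
  move: (o 0) (o 1) (o 2) (o 3) (o 4) (o 5) => [] [] [] [] [] [].

(** The tests are invariant under rotation and reflection, so a private compass and chirality do not
    affect their outcome. *)
Lemma fine_frame o c b : fine (o \o frame c b) = fine o.
Proof. by case_pattern o; case: b; case_ord c; vm_compute. Qed.

Lemma acute_frame o c b : acute (o \o frame c b) = acute o.
Proof. by case_pattern o; case: b; case_ord c; vm_compute. Qed.

Lemma obtuse_frame o c b : obtuse (o \o frame c b) = obtuse o.
Proof. by case_pattern o; case: b; case_ord c; vm_compute. Qed.

Lemma boundary_frame o c b l :
  boundary (o \o frame c b) l = boundary o (frame c b l).
Proof.
rewrite /boundary /frame /=; case: b => //; first by rewrite !addrA.
by rewrite !opprD opprK !addrA [X in ~~ X]andbC.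
Qed.

Lemma unit_vec_frame c b k :
  unit_vec (frame c b k) = unit_vec (frame c b 0) *~ (unit_vec k).1
    + unit_vec (frame c b 1) *~ (unit_vec k).2.
Proof. by case: b; case_ord c; case_ord k; vm_compute. Qed.

(** * Coordinates in rotated and reflected frames *)

Definition occ (S : {fset node}) (v : node) : 'I_6 -> bool :=
  fun d => v + unit_vec d \in S.

Lemma mulrz_pair (u : node) (z : int) : u *~ z = (u.1 * z, u.2 * z) :> node.
Proof.
case: u => x y; case: z => n.
  rewrite -!pmulrn; elim: n => [|n IHn]; first by rewrite !mulr0.
  by rewrite mulrS IHn; congr pair => /=; lia.
rewrite NegzE !mulrNz -!pmulrn; elim: n => [|n IHn].
  by congr pair => /=; lia.
rewrite mulrS opprD IHn; congr pair => /=; lia.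
Qed.

Definition grid_pt (p : node) (d e : 'I_6) (i j : int) : node :=
  p + unit_vec d *~ i + unit_vec e *~ j.

Lemma grid_ptE p d e i j : grid_pt p d e i j =
  (p.1 + (unit_vec d).1 * i + (unit_vec e).1 * j,
   p.2 + (unit_vec d).2 * i + (unit_vec e).2 * j).
Proof. by rewrite /grid_pt !mulrz_pair. Qed.

Definition pt (p : node) (c : 'I_6) (b : bool) (i j : int) : node :=
  grid_pt p (frame c b 0) (frame c b 1) i j.

Definition line (v : node) (d : 'I_6) (z : int) : node := v + unit_vec d *~ z.

Definition sees (ty : ('I_6 -> bool) -> bool) (S : {fset node}) (v : node)
    (d : 'I_6) : Prop :=
  exists r : nat, [/\ (0 < r)%N,
    forall s : nat, (s <= r)%N -> line v d s \in S & ty (occ S (line v d r))].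

(** What the amoebots jointly verify, stated without labels or circuits; it separates the geometry
    from the protocol. *)
Definition certified (S : {fset node}) : Prop := forall v, v \in S ->
  [/\ fine (occ S v),
      obtuse (occ S v) -> forall d, boundary (occ S v) d -> sees acute S v d
    & acute (occ S v) -> forall d, boundary (occ S v) d -> sees obtuse S v d].

Lemma ptE p c b i j : pt p c b i j =
  (p.1 + (unit_vec (frame c b 0)).1 * i + (unit_vec (frame c b 1)).1 * j,
   p.2 + (unit_vec (frame c b 0)).2 * i + (unit_vec (frame c b 1)).2 * j).
Proof. exact: grid_ptE. Qed.

Lemma lineE v d z :
  line v d z = (v.1 + (unit_vec d).1 * z, v.2 + (unit_vec d).2 * z).
Proof. by rewrite /line mulrz_pair. Qed.

Lemma pt_add p c b i j k : pt p c b i j + unit_vec (frame c b k) =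
  pt p c b (i + (unit_vec k).1) (j + (unit_vec k).2).
Proof.
by rewrite unit_vec_frame !ptE !mulrz_pair; congr pair => /=; ring.
Qed.

Lemma occ_ptE S p c b i j o : o = occ S (pt p c b i j) \o frame c b ->
  (o 0 = (pt p c b (i + 1) j \in S)) *
  (o 1 = (pt p c b i (j + 1) \in S)) *
  (o 2 = (pt p c b (i - 1) (j + 1) \in S)) *
  (o 3 = (pt p c b (i - 1) j \in S)) *
  (o 4 = (pt p c b i (j - 1) \in S)) *
  (o 5 = (pt p c b (i + 1) (j - 1) \in S)).
Proof. by move=> -> /=; rewrite /occ !pt_add /unit_vec /= !addr0. Qed.

Lemma pt_line p c b i : pt p c b i 0 = line p (frame c b 0) i.
Proof. by rewrite /pt /grid_pt mulr0z addr0. Qed.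

Lemma pt0 p c b : pt p c b 0 0 = p.
Proof. by rewrite /pt /grid_pt !mulr0z !addr0. Qed.

(** The reflected frame exchanges the two sides at a 60 degree corner, so one lemma on sides serves
    both. *)
Lemma pt_swap p c i j : pt p (c + 1) false i j = pt p c true j i.
Proof.
rewrite !ptE /frame !addr0 !subr0 addrK.
by congr pair; ring.
Qed.

(** Frame at the far end of the bottom side: direction 0 climbs the right side and direction 1
    points inward. [pt_top] is its mirror image for the top side. *)
Lemma pt_right p c m i j :
  pt (pt p c true m 0) (c + 1) true i j = pt p c true (m - j) (i + j).
Proof.
have e2 : unit_vec (c + 1 + 1) = unit_vec (c + 1) - unit_vec c.
  by case_ord c; vm_compute.
by rewrite !ptE /frame !addr0 e2; congr pair => /=; ring.
Qed.

Lemma pt_top p c n i j :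
  pt (pt p c true 0 n) c false i j = pt p c true (i + j) (n - j).
Proof.
have e2 : unit_vec (c - 1) = unit_vec c - unit_vec (c + 1).
  by case_ord c; vm_compute.
by rewrite !ptE /frame !addr0 !subr0 e2; congr pair => /=; ring.
Qed.

(** * Walking along a side *)

(** Direction 3 leads back along the side, 2 lies on the inner and 4 on the outer side. Only the
    axes 1 and 2 remain possible; both keep 5 empty, and both fill 1 when 0 is occupied. *)
Lemma side_step o : fine o -> o 2 -> o 3 -> ~~ o 4 ->
  if o 0 then o 1 && ~~ o 5 else ~~ o 5.
Proof. by case_pattern o; vm_compute. Qed.

Lemma side_end o : fine o -> o 2 -> o 3 -> ~~ o 4 -> acute o || obtuse o ->
  [/\ ~~ o 0, ~~ o 5, o 1 = obtuse o & acute o = ~~ obtuse o].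
Proof. by case_pattern o; vm_compute. Qed.

Lemma succz_add_sub1 (s : nat) : (s.+1%:Z + 1 = s.+2) * (s.+1%:Z - 1 = s).
Proof. by split; lia. Qed.

Section Sides.

Variables (S : {fset node}) (c : 'I_6) (b : bool) (v : node).
Hypothesis fineS : forall w, w \in S -> fine (occ S w).

Let o i j : 'I_6 -> bool := occ S (pt v c b i j) \o frame c b.

Let fine_o i j : pt v c b i j \in S -> fine (o i j).
Proof. by rewrite /o fine_frame; apply: fineS. Qed.

Let oE i j := occ_ptE (erefl (o i j)).

(* The side runs in direction 0 of the frame, with [S] in direction 1 and its
   complement in direction 5. *)
Lemma side_run (r : nat) :
  pt v c b 0 1 \in S -> pt v c b 1 (-1) \notin S ->
  (forall s : nat, (s <= r)%N -> pt v c b s 0 \in S) ->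
  forall s : nat, (s < r)%N ->
    pt v c b s 1 \in S /\ pt v c b s.+1 (-1) \notin S.
Proof.
move=> S01 S1N run; elim=> [|s IHs] // lt_sr.
have [Ss1 SsN] := IHs (ltnW lt_sr).
have := @side_step (o s.+1 0) (fine_o (run _ (ltnW lt_sr))).
have := run _ (ltnW (ltnW lt_sr)); have := run _ lt_sr.
rewrite !oE !succz_add_sub1 !add0r.
by move=> -> Ss /(_ Ss1 Ss SsN) /andP[].
Qed.

Lemma side_corner (r : nat) :
  (0 < r)%N -> pt v c b 0 1 \in S -> pt v c b 1 (-1) \notin S ->
  (forall s : nat, (s <= r)%N -> pt v c b s 0 \in S) ->
  let o' := occ S (pt v c b r 0) in acute o' || obtuse o' ->
  [/\ pt v c b r.+1 0 \notin S, pt v c b r.+1 (-1) \notin S,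
      (pt v c b r 1 \in S) = obtuse o' & acute o' = ~~ obtuse o'].
Proof.
case: r => // r _ S01 S1N run o'.
have [Sr1 SrN] := side_run S01 S1N run (ltnSn r).
have := @side_end (o r.+1 0) (fine_o (run _ (leqnn _))).
have := run _ (leqnSn r).
rewrite /o acute_frame obtuse_frame -/o' -/(o r.+1 0) !oE !succz_add_sub1 !add0r.
by move=> Sr step corner; case: (step Sr1 Sr SrN corner).
Qed.

End Sides.

(** * Certified structures with a 60 degree corner *)

(** An integer form anchored at a corner whose sides [l] and [l + 1] make 60 degrees;
    [lattice_forms] shows that nothing is lost. *)
Definition lattice_parallelogram (S : {fset node}) : Prop :=
  exists (p : node) (l : 'I_6) (m n : nat), forall v : node,
    v \in S <-> exists i j : nat,
      [/\ (i <= m)%N, (j <= n)%N & v = pt p l true i j].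

Lemma connected_ind (S : {fset node}) (p : node) (Q : node -> Prop) :
  connected_structure S -> p \in S -> Q p ->
  (forall v d, v \in S -> Q v -> v + unit_vec d \in S -> Q (v + unit_vec d)) ->
  forall v, v \in S -> Q v.
Proof.
move=> connS Sp Qp stepQ v Sv.
suff path_ind (x y : S) : connect (fun x y : S => adjacent (val x) (val y)) x y ->
    Q (fsval x) -> Q (fsval y).
  exact: path_ind (connS [` Sp]%fset [` Sv]%fset) Qp.
case/connectP=> s pth ->; elim: s x pth => [|z s IHs] x //=.
case/andP=> /existsP[d /eqP zE] pth Qx; apply: IHs pth _.
by rewrite zE; apply: stepQ Qx _; rewrite -?zE; apply: valP.
Qed.

Lemma acute_atE o l (o' := o \o frame l true) : acute_at o l ->
  [/\ acute o, o' 0 && o' 1 & ~~ [|| o' 2, o' 3, o' 4 | o' 5]].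
Proof. by rewrite {}/o'; case_pattern o; case_ord l; vm_compute. Qed.

Lemma boundary0 o : boundary o 0 = o 0 && ~~ (o 1 && o 5).
Proof. by case_pattern o; vm_compute. Qed.

Lemma acute_or_obtuse o : acute o || obtuse o -> obtuse o = ~~ acute o.
Proof. by case_pattern o; vm_compute. Qed.

(** Every axis forces direction 1: axis 1 because 0 and 2 are occupied, axes 0 and 2 because the
    occupied neighbor along them requires both its flanks. *)
Lemma fine_fill o : fine o -> o 0 -> o 2 -> o 3 -> o 1.
Proof. by case_pattern o; vm_compute. Qed.

(** The beep test supplies a corner of the opposite kind further along, and [side_corner] shows that
    the side stops there. The arbitrary frame lets this serve all four sides. *)
Lemma certified_side (S : {fset node}) v c b (o := occ S v) :
  certified S -> v \in S -> acute o || obtuse o ->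
  pt v c b 1 0 \in S -> pt v c b 0 1 \in S -> pt v c b 1 (-1) \notin S ->
  exists r : nat, let o' := occ S (pt v c b r 0) in
  [/\ (0 < r)%N /\ (pt v c b r 1 \in S) = acute o,
      forall s : nat, (s <= r)%N -> pt v c b s 0 \in S,
      forall s : nat, (s < r)%N ->
        pt v c b s 1 \in S /\ pt v c b s.+1 (-1) \notin S,
      pt v c b r.+1 0 \notin S /\ pt v c b r.+1 (-1) \notin S
    & obtuse o' = acute o /\ acute o' = obtuse o].
Proof.
move=> certS Sv corner S10 S01 S1N.
have fineS w : w \in S -> fine (occ S w) by case/certS.
have [_ see_acute see_obtuse] := certS v Sv.
have side_d : boundary o (frame c b 0).
  rewrite -boundary_frame boundary0.
  have oE := occ_ptE (erefl (occ S (pt v c b 0 0) \o frame c b)).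
  move: oE; rewrite pt0 -/o => oE; rewrite !oE !add0r S10.
  by rewrite (negPf S1N) andbF.
have [r [r_gt0 run corner']] : exists r : nat, let o' := occ S (pt v c b r 0) in
    [/\ (0 < r)%N, forall s : nat, (s <= r)%N -> pt v c b s 0 \in S
      & if acute o then obtuse o' else acute o'].
  have [r [r_gt0 run ty]] :
      sees (if acute o then obtuse else acute) S v (frame c b 0).
    move: corner; case: (boolP (acute o)) => [/see_obtuse see _|_ /see_acute see];
      exact: see.
  exists r; rewrite pt_line; split=> //; last by case: (acute o) ty.
  by move=> s /run; rewrite pt_line.
have side := side_run fineS S01 S1N run.
have /= := side_corner fineS r_gt0 S01 S1N run.
case=> [|n0 n5 r1 acuteE]; first by case: (acute o) corner' => ->; rewrite ?orbT.
exists r; split=> //.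
  by split=> //; rewrite r1; case: (acute o) corner' => //; rewrite acuteE => /negPf.
by rewrite acuteE (acute_or_obtuse corner); case: (acute o) corner' => [->|];
  rewrite ?acuteE // => /negPf ->.
Qed.

(** Connectedness confines [S] once all outer neighbors of the parallelogram are empty. The ranges
    differ because [(m + 1, -1)] and [(-1, n + 1)] are adjacent to it, by directions 5 and 2,
    whereas [(-1, -1)] and [(m + 1, n + 1)] are not. *)
Lemma framed_lattice (S : {fset node}) p l (m n : nat)
    (X := fun i j : int => pt p l true i j \in S) :
  connected_structure S ->
  (forall i j : nat, (i <= m)%N -> (j <= n)%N -> X i j) ->
  (forall i : nat, (i <= m.+1)%N -> ~~ X i (-1)) ->
  (forall i : nat, (i <= m)%N -> ~~ X i n.+1) ->
  (forall j : nat, (j <= n.+1)%N -> ~~ X (-1) j) ->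
  (forall j : nat, (j <= n)%N -> ~~ X m.+1 j) -> lattice_parallelogram S.
Proof.
move=> connS inside bot top left right; exists p, l, m, n => v; split; last first.
  by case=> i [j [le_im le_jn ->]]; apply: inside.
move: v; apply: (connected_ind (p := p) connS).
- by have := inside 0 0 (leq0n _) (leq0n _); rewrite /X pt0.
- by exists 0, 0; rewrite pt0.
move=> _ d _ [i [j [le_im le_jn ->]]].
have -> : d = frame l true (d - l) by rewrite /frame addrC subrK.
rewrite pt_add; move: (d - l) => {}d.
set x := _ + _; set y := _ + _ => Xxy.
suff [le_xm le_yn] : 0 <= x <= m%:Z /\ 0 <= y <= n%:Z.
  by exists `|x|%N, `|y|%N; split; try lia; congr pt; lia.
have {}bot : y = -1 -> ~ 0 <= x <= m.+1%:Z.
  by move=> yE le_x; have := bot `|x|%N; rewrite gez0_abs -?yE /X ?Xxy; lia.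
have {}top : y = n.+1%:Z -> ~ 0 <= x <= m%:Z.
  by move=> yE le_x; have := top `|x|%N; rewrite gez0_abs -?yE /X ?Xxy; lia.
have {}left : x = -1 -> ~ 0 <= y <= n.+1%:Z.
  by move=> xE le_y; have := left `|y|%N; rewrite gez0_abs -?xE /X ?Xxy; lia.
have {}right : x = m.+1%:Z -> ~ 0 <= y <= n%:Z.
  by move=> xE le_y; have := right `|y|%N; rewrite gez0_abs -?xE /X ?Xxy; lia.
by move: bot top left right; rewrite {Xxy}/x {x}/y {y}; case_ord d;
  rewrite /unit_vec /=; lia.
Qed.

(** The sides at [p] have lengths [m] and [n], the right and top sides lengths [n'] and [m'], at
    first unrelated. Filling rows gives [n <= n'], from which [m' = m] and then [n' = n] follow. *)
Lemma acute_lattice (S : {fset node}) p l :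
  connected_structure S -> certified S -> p \in S -> acute_at (occ S p) l ->
  lattice_parallelogram S.
Proof.
move=> connS certS Sp p_acute.
have fineS w : w \in S -> fine (occ S w) by case/certS.
pose X i j := pt p l true i j \in S.
have [acute_p pE] := acute_atE p_acute.
have oE i j := occ_ptE (erefl (occ S (pt p l true i j) \o frame l true)).
move: pE; rewrite -{1 2 3 4 5 6}(pt0 p l true) !oE !add0r -!/(X _ _).
case/andP=> X10 X01; rewrite !negb_or => /and4P[XN1 XN0 X0N X1N].
have corner_p : acute (occ S p) || obtuse (occ S p) by rewrite acute_p.
have [m] := certified_side certS Sp corner_p X10 X01 X1N.
rewrite /= acute_p => -[[m_gt0 Xm1] bot_run bot_side [XM0 XMN] [obtuse_q acute_q]].
have [n] : exists n : nat, let o' := occ S (pt p l true 0 n) in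
    [/\ (0 < n)%N /\ X 1 n, forall s : nat, (s <= n)%N -> X 0 s,
       forall s : nat, (s < n)%N -> X 1 s /\ ~~ X (-1) s.+1,
       ~~ X 0 n.+1 /\ ~~ X (-1) n.+1
     & obtuse o' /\ acute o' = obtuse (occ S p)].
  have [] := @certified_side S p (l + 1) false certS Sp corner_p;
    rewrite ?pt_swap //.
  move=> n; rewrite /= acute_p !pt_swap => -[? run side ? ?]; exists n.
  by split=> // s; [move/run|move/side]; rewrite !pt_swap.
move=> [[n_gt0 X1n] left_run left_side [X0M XNM] [obtuse_r acute_r]].
have obtuse_p : obtuse (occ S p) = false by rewrite acute_or_obtuse ?acute_p.
rewrite obtuse_p in acute_q acute_r.
have Xeq i j i' j' : i = i' -> j = j' -> X i j -> X i' j' by move=> <- <-.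
have nXeq i j i' j' : i = i' -> j = j' -> ~~ X i j -> ~~ X i' j'.
  by move=> <- <-.
(* The right side leaves a 120 degree corner, hence ends at a 60 degree one, whose upper left
   neighbor [(m - 1, n' + 1)] is empty. *)
have [n'] : exists n' : nat,
    [/\ (0 < n')%N /\ ~~ X (m%:Z - 1) n'.+1,
       forall s : nat, (s <= n')%N -> X m s,
       forall s : nat, (s <= n')%N -> ~~ X m.+1 s
     & ~~ X m n'.+1].
  have [] := @certified_side S (pt p l true m 0) (l + 1) true certS;
    rewrite ?obtuse_q ?orbT ?pt_right ?add0r ?subr0 //.
  - exact: bot_run.
  - rewrite -/(X _ _) -(prednK m_gt0) succz_add_sub1.
    by have [|] := bot_side m.-1; rewrite ?prednK.
  - by apply: nXeq XM0; clear; lia.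
  move=> n'; rewrite /= acute_q !pt_right => -[[n_gt0' X1n'] run side [a b] _].
  exists n'; split.
  - by split=> //; apply: (nXeq _ _ _ _ _ _ (negbT X1n')); clear; lia.
  - by move=> s /run; rewrite pt_right; apply: Xeq; clear; lia.
  - move=> s; rewrite leq_eqVlt => /orP[/eqP->|/side[_]].
      by rewrite -/(X _ _) in b; apply: nXeq b; clear; lia.
    by rewrite pt_right; apply: nXeq; clear; lia.
  by apply: nXeq a; clear; lia.
have [m'] : exists m' : nat,
    [/\ forall s : nat, (s <= m')%N -> X s n,
        forall s : nat, (s <= m')%N -> ~~ X s n.+1
      & ~~ X m'.+1 n].
  have [] := @certified_side S (pt p l true 0 n) l false certS;
    rewrite ?obtuse_r ?orbT ?pt_top ?add0r ?subr0 //.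
  - exact: left_run.
  - rewrite -/(X _ _) -(prednK n_gt0) succz_add_sub1.
    by have [|] := left_side n.-1; rewrite ?prednK.
  - by apply: nXeq X0M; clear; lia.
  move=> m'; rewrite /= acute_r !pt_top => -[_ run side [a b] _].
  exists m'; split.
  - by move=> s /run; rewrite pt_top; apply: Xeq; clear; lia.
  - move=> s; rewrite leq_eqVlt => /orP[/eqP->|/side[_]].
      by apply: nXeq b; clear; lia.
    by rewrite pt_top; apply: nXeq; clear; lia.
  by apply: nXeq a; clear; lia.
move=> [top_run top_out top_end] [[n_gt0' top_left] right_run right_out right_end].
(* Rows are filled upward, each from the left side onward. Row [n'.+1] is still reached, since
   filling a row uses the right side only in the row below. *)
have fill (j i : nat) : (j <= n)%N -> (j <= n'.+1)%N -> (i < m)%N -> X i j.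
  elim: j i => [|j IHj] i le_jn le_jn' lt_im; first exact: bot_run (ltnW lt_im).
  elim: i lt_im => [|i IHi] lt_im; first exact: left_run.
  have Xij : X i.+1 j by apply: IHj => //; apply: ltnW.
  have := fineS _ Xij; rewrite -(fine_frame _ l true) => /fine_fill.
  rewrite !oE -!/(X _ _) => step.
  apply: (Xeq i.+1 (j%:Z + 1)); [by []|by clear; lia|apply: step].
  - have [lt_i2|le_i2] := ltnP i.+2 m.
      apply: (Xeq i.+2 j); [by clear; lia|by clear; lia|].
      by apply: IHj => //; exact: ltnW.
    by apply: (Xeq m j);
      [move: le_i2 lt_im; clear; lia|by clear; lia|apply: right_run].
  - by apply: (Xeq i j.+1); [by clear; lia|by clear; lia|apply: IHi; exact: ltnW].
  - apply: (Xeq i j); [by clear; lia|by clear; lia|].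
    by apply: IHj => //; apply: ltnW => //; exact: ltnW.
have le_nn' : (n <= n')%N.
  rewrite leqNgt; apply/negP => lt_n'n; move/negP: top_left; apply.
  apply: (Xeq m.-1 n'.+1); [by move: m_gt0; clear; lia|by clear; lia|].
  by apply: fill; rewrite ?prednK.
(* A longer top side would enter the empty column [m.+1]; a shorter one would stop before a node
   already known to be occupied. *)
have eq_m : m' = m.
  apply/eqP; rewrite eqn_leq; apply/andP; split; rewrite leqNgt; apply/negP => lt_m.
    by move/negP: (right_out n le_nn'); apply; apply: top_run.
  move/negP: top_end; apply; move: lt_m; rewrite leq_eqVlt => /orP[/eqP->|lt_m].
    exact: right_run.
  by apply: fill => //; apply: ltnW.
have eq_n : n' = n.
  apply/eqP; rewrite eqn_leq le_nn' andbT leqNgt; apply/negP => lt_n.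
  have := top_out m; rewrite eq_m leqnn => /(_ isT)/negP.
  by apply; apply: right_run.
subst m' n'; apply: (framed_lattice (p := p) (l := l) (m := m) (n := n) connS) => //.
- move=> i j; rewrite leq_eqVlt => /orP[/eqP->|lt_im] le_jn; first exact: right_run.
  by apply: fill => //; apply: leqW.
- case=> [|i] //; rewrite ltnS leq_eqVlt => /orP[/eqP->|/bot_side[]] //.
- case=> [|j] //; rewrite ltnS leq_eqVlt => /orP[/eqP->|/left_side[]] //.
Qed.

(** * Segments and the extremal node *)

Lemma unit_vec_neq0 d : unit_vec d != 0.
Proof. by case_ord d. Qed.

Lemma line_inj v d : injective (line v d).
Proof.
move=> z z'; rewrite !lineE => -[/addrI e1 /addrI e2].
by move: e1 e2; case_ord d; rewrite /unit_vec /=; lia.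
Qed.

Lemma line_exits (S : {fset node}) v d :
  exists s : nat, line v d s.+1 \notin S.
Proof.
apply: contrapT => /forallNP all_in.
have inS (s : nat) : line v d s.+1 \in S by apply/negPn/negP/all_in.
pose f (i : 'I_#|{: S}|.+1) : S := [` inS i]%fset.
have /leq_card : injective f.
  by move=> i j /(congr1 val)/= /line_inj eq_ij; apply: val_inj; move: eq_ij => /=; lia.
by rewrite card_ord ltnn.
Qed.

(** Describes the end of a segment, including a single node. *)
Definition at_most_toward (o : 'I_6 -> bool) (k : 'I_6) : bool :=
  all (fun d => (d == k) || ~~ o d) directions.

Lemma at_most_toward_frame o k (o' := o \o frame k true) : at_most_toward o k ->
  ~~ [|| o' 1, o' 2, o' 3, o' 4 | o' 5].
Proof. by rewrite {}/o'; case_pattern o; case_ord k; vm_compute. Qed.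

Lemma fine_through o : fine o -> ~~ o 2 -> o 3 -> ~~ o 4 -> ~~ o 1 && ~~ o 5.
Proof. by case_pattern o; vm_compute. Qed.

Lemma segment_lattice (S : {fset node}) p k :
  connected_structure S -> (forall w, w \in S -> fine (occ S w)) ->
  p \in S -> at_most_toward (occ S p) k -> lattice_parallelogram S.
Proof.
move=> connS fineS Sp p_end.
(* The length [m] comes from the first unoccupied node on the ray, which exists as [S] is finite. *)
have [m out_m in_m] : exists2 m : nat, line p k m.+1 \notin S &
    forall s : nat, (s <= m)%N -> line p k s \in S.
  case: (ex_minnP (line_exits S p k)) => m out_m min_m; exists m => //.
  case=> [|s] lt_sm; first by rewrite /line mulr0z addr0.
  by apply: contraLR lt_sm => /min_m; rewrite -leqNgt.
pose X i j := pt p k true i j \in S.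
have Xline i : X i 0 = (line p k i \in S) by rewrite /X pt_line /frame addr0.
have oE i j := occ_ptE (erefl (occ S (pt p k true i j) \o frame k true)).
move/at_most_toward_frame: p_end; rewrite -{1 2 3 4 5}(pt0 p k true) !oE !add0r.
rewrite -!/(X _ _) !negb_or => /and5P[X01 XN1 XN0 X0N X1N].
have sides (s : nat) : (s <= m)%N -> [/\ ~~ X s 1, ~~ X s (-1) & ~~ X s.+1 (-1)].
  elim: s => [|s IHs] // lt_sm; have [Xs1 XsN XsN'] := IHs (ltnW lt_sm).
  have Xs : X s.+1 0 by rewrite Xline in_m.
  have := fineS _ Xs; rewrite -(fine_frame _ k true) => /fine_through.
  rewrite !oE -!/(X _ _) !succz_add_sub1 !add0r.
  by rewrite !Xline in_m 1?ltnW // => /(_ Xs1 isT XsN') /andP[].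
apply: (framed_lattice (p := p) (l := k) (m := m) (n := 0) connS).
- by move=> i j le_im; rewrite leqn0 => /eqP->; rewrite -/(X _ _) Xline in_m.
- by case=> [|i] // /sides[].
- by move=> i /sides[].
- by case=> [|[|]].
- by move=> j; rewrite leqn0 => /eqP->; rewrite -/(X _ _) Xline.
Qed.

Lemma extremal_pattern o : fine o -> ~~ o 3 -> ~~ o 4 -> ~~ o 5 ->
  [|| has (at_most_toward o) directions, acute o | obtuse o && boundary o 0].
Proof. by case_pattern o; vm_compute. Qed.

Lemma certified_lattice (S : {fset node}) :
  connected_structure S -> (exists v, v \in S) -> certified S ->
  lattice_parallelogram S.
Proof.
move=> connS [v0 Sv0] certS.
have fineS w : w \in S -> fine (occ S w) by case/certS.
have acuteS w : w \in S -> acute (occ S w) -> lattice_parallelogram S.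
  by move=> Sw /hasP[l _]; apply: acute_lattice.
(* On unit vectors this form is negative exactly in directions 3, 4, 5. *)
pose height (v : S) := (fsval v).1 + (fsval v).2 * 2.
case: (@arg_minP _ _ _ [` Sv0]%fset xpredT height isT) => -[p Sp] _ p_min.
have out d : (unit_vec d).1 + (unit_vec d).2 * 2 < 0 -> ~~ occ S p d.
  move=> d_lt0; apply/negP => Sd; have := p_min [` Sd]%fset isT.
  by rewrite /height /=; lia.
have [o3 o4 o5] : [/\ ~~ occ S p 3, ~~ occ S p 4 & ~~ occ S p 5].
  by split; apply: out.
case/or3P: (extremal_pattern (fineS _ Sp) o3 o4 o5).
- by case/hasP=> k _; apply: segment_lattice.
- exact: acuteS.
(* At a 120 degree corner the beep test exhibits a 60 degree corner along direction 0. *)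
case/andP=> obt bd; have [_ /(_ obt 0 bd)[r [_ run ty]] _] := certS p Sp.
by apply: acuteS ty; apply: run.
Qed.

(** * Parallelograms pass all tests *)

Lemma pt_inj p l i j i' j' :
  pt p l true i j = pt p l true i' j' -> i = i' /\ j = j'.
Proof.
rewrite !ptE => -[]; move: p.1 p.2 => x y.
by case_ord l; rewrite /frame /unit_vec /=; lia.
Qed.

Lemma line_pt p c b i j k z : line (pt p c b i j) (frame c b k) z =
  pt p c b (i + (unit_vec k).1 * z) (j + (unit_vec k).2 * z).
Proof.
by rewrite lineE unit_vec_frame !mulrz_pair !ptE; congr pair => /=; ring.
Qed.

(* The occupancy pattern of a node of a lattice parallelogram; [a], [b], [c]
   and [d] tell whether there is a neighbor in directions 0, 1, 3 and 4. *)
Definition product_pattern (a b c d : bool) : 'I_6 -> bool :=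
  fun k => nth false [:: a; b; c && b; c; d; a && d] k.

Lemma product_pattern_fine a b c d : fine (product_pattern a b c d).
Proof. by case: a b c d => [] [] [] []; vm_compute. Qed.

(** The node ends its row or column with nothing behind it, and [ty] holds of the pattern at the
    other end, where the two flags along [k] are exchanged. *)
Definition opposite_end (ty : ('I_6 -> bool) -> bool) (a b c d : bool) (k : 'I_6) :=
  [|| [&& k == 0, a, ~~ c & ty (product_pattern false b true d)],
      [&& k == 1, b, ~~ d & ty (product_pattern a false c true)],
      [&& k == 3, c, ~~ a & ty (product_pattern true b false d)]
    | [&& k == 4, d, ~~ b & ty (product_pattern a true c false)]].

Lemma acute_opposite a b c d k (o := product_pattern a b c d) :
  acute o -> boundary o k -> opposite_end obtuse a b c d k.
Proof. by case: a b c d @o => [] [] [] []; case_ord k; vm_compute. Qed.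

Lemma obtuse_opposite a b c d k (o := product_pattern a b c d) :
  obtuse o -> boundary o k -> opposite_end acute a b c d k.
Proof. by case: a b c d @o => [] [] [] []; case_ord k; vm_compute. Qed.

Lemma lattice_certified (S : {fset node}) :
  lattice_parallelogram S -> certified S.
Proof.
case=> p [l [m [n memS]]].
have inS (x y : int) :
    (pt p l true x y \in S) = (0 <= x <= m%:Z) && (0 <= y <= n%:Z).
  apply/idP/idP.
    by case/memS=> i [j [le_im le_jn /pt_inj[-> ->]]]; lia.
  move=> range; apply/memS; exists `|x|%N, `|y|%N.
  by split; [lia | lia | congr pt; lia].
have patternE (x y : int) : pt p l true x y \in S ->
    occ S (pt p l true x y) \o frame l true =
    product_pattern (x < m%:Z) (y < n%:Z) (0 < x) (0 < y).
  rewrite inS => range; set o := _ \o _; rewrite (pattern_bits o).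
  have oE := occ_ptE (erefl o); rewrite !oE !inS /product_pattern.
  move: range; clear => range; apply: funext => k.
  by congr (nth false _ _); do ![congr cons]; lia.
have seesE (ty : ('I_6 -> bool) -> bool) i j k (r : nat) : (0 < r)%N ->
    (forall s : nat, (s <= r)%N ->
       pt p l true (i + (unit_vec k).1 * s) (j + (unit_vec k).2 * s) \in S) ->
    ty (occ S (pt p l true (i + (unit_vec k).1 * r) (j + (unit_vec k).2 * r))) ->
    sees ty S (pt p l true i j) (frame l true k).
  move=> r_gt0 run tyr; exists r.
  by split=> // [s /run|]; rewrite line_pt.
have opposite (ty : ('I_6 -> bool) -> bool) i j k :
    (forall o, ty (o \o frame l true) = ty o) ->
    pt p l true i j \in S ->
    opposite_end ty (i < m%:Z) (j < n%:Z) (0 < i) (0 < j) k ->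
    sees ty S (pt p l true i j) (frame l true k).
  (* Directions 0, 1, 3 and 4 in turn; the other end is at distance [m] along a row and [n] along a
     column. *)
  move=> ty_frame; rewrite inS => range /or4P[]; case/and4P=> /eqP-> lt1 lt2 tyo.
  - apply: (@seesE _ _ _ _ m); rewrite /unit_vec /=.
    + by move: range lt1 lt2; clear; lia.
    + by move=> s le_s; rewrite inS; move: range lt1 lt2 le_s; clear; lia.
    rewrite -ty_frame patternE ?inS; last by move: range lt1 lt2; clear; lia.
    move: tyo; congr (is_true (ty (product_pattern _ _ _ _)));
      by move: range lt1 lt2; clear; lia.
  - apply: (@seesE _ _ _ _ n); rewrite /unit_vec /=.
    + by move: range lt1 lt2; clear; lia.
    + by move=> s le_s; rewrite inS; move: range lt1 lt2 le_s; clear; lia.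
    rewrite -ty_frame patternE ?inS; last by move: range lt1 lt2; clear; lia.
    move: tyo; congr (is_true (ty (product_pattern _ _ _ _)));
      by move: range lt1 lt2; clear; lia.
  - apply: (@seesE _ _ _ _ m); rewrite /unit_vec /=.
    + by move: range lt1 lt2; clear; lia.
    + by move=> s le_s; rewrite inS; move: range lt1 lt2 le_s; clear; lia.
    rewrite -ty_frame patternE ?inS; last by move: range lt1 lt2; clear; lia.
    move: tyo; congr (is_true (ty (product_pattern _ _ _ _)));
      by move: range lt1 lt2; clear; lia.
  - apply: (@seesE _ _ _ _ n); rewrite /unit_vec /=.
    + by move: range lt1 lt2; clear; lia.
    + by move=> s le_s; rewrite inS; move: range lt1 lt2 le_s; clear; lia.
    rewrite -ty_frame patternE ?inS; last by move: range lt1 lt2; clear; lia.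
    move: tyo; congr (is_true (ty (product_pattern _ _ _ _)));
      by move: range lt1 lt2; clear; lia.
move=> v Sv; have [i [j [_ _ vE]]] := (memS v).1 Sv.
have patE := patternE i j; rewrite -vE in patE; have {}patE := patE Sv.
have frameE d : d = frame l true (d - l) by rewrite /frame addrC subrK.
split.
- by rewrite -(fine_frame _ l true) patE product_pattern_fine.
- rewrite -(obtuse_frame _ l true) patE => obt d; rewrite (frameE d) -boundary_frame patE.
  move/(obtuse_opposite obt); rewrite vE; apply: opposite; last by rewrite -vE.
  by move=> o; apply: acute_frame.
rewrite -(acute_frame _ l true) patE => acu d; rewrite (frameE d) -boundary_frame patE.
move/(acute_opposite acu); rewrite vE; apply: opposite; last by rewrite -vE.
by move=> o; apply: obtuse_frame.
Qed.

(** * From the plane to integer coordinates *)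

Lemma embed_combE (R : realType) (v p u w : node) (s t : R) :
  embed R v = embed R p + s *: embed R u + t *: embed R w <->
  v.1%:~R = p.1%:~R + s * u.1%:~R + t * w.1%:~R :> R /\
  v.2%:~R = p.2%:~R + s * u.2%:~R + t * w.2%:~R :> R.
Proof.
have sqrt3 : Num.sqrt 3 != 0 :> R by rewrite sqrtr_eq0 -ltNge; lra.
split=> [eq_v|[eq1 eq2]].
  have := congr1 (fun x : 'rV[R]_2 => x 0 0) eq_v.
  have := congr1 (fun x : 'rV[R]_2 => x 0 1) eq_v.
  rewrite !mxE /= => eq1 eq0.
  have eq2 : v.2%:~R = p.2%:~R + s * u.2%:~R + t * w.2%:~R :> R.
    apply: (mulfI sqrt3); lra.
  split=> //; lra.
apply/rowP => -[[|[|//]] i_lt]; rewrite !mxE /=; first by rewrite eq1 eq2; lra.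
by rewrite eq2; ring.
Qed.

Lemma embed_inj (R : realType) : injective (embed R).
Proof.
move=> [x1 x2] [y1 y2] eq_xy.
have [] := (embed_combE (R := R) (x1, x2) (y1, y2) 0 0 0 0).1.
  by rewrite !scale0r !addr0.
by rewrite /= !mul0r !addr0 => /intr_inj-> /intr_inj->.
Qed.

Lemma unit_vec_det (d e : 'I_6) : e != d -> e != d + 3 ->
  ((unit_vec d).1 * (unit_vec e).2 - (unit_vec d).2 * (unit_vec e).1) ^+ 2 = 1.
Proof. by case_ord d; case_ord e. Qed.

(** Two non-parallel unit vectors have determinant 1 or -1, so they form a lattice basis and the
    real coordinates of a node are integers. *)
Lemma parallelogram_embed (R : realType) (p : node) (d e : 'I_6) (m n : nat) v :
  e != d -> e != d + 3 ->
  parallelogram p d e m n (embed R v) <->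
  exists i j : nat, [/\ (i <= m)%N, (j <= n)%N & v = grid_pt p d e i j].
Proof.
move=> neq_ed neq_ed3; split; last first.
  case=> i [j [le_im le_jn ->]]; exists i%:R, j%:R.
  rewrite !ler0n !ler_nat le_im le_jn; split=> //.
  apply/embed_combE; rewrite grid_ptE /=.
  by rewrite !rmorphD !rmorphM /=; split; ring.
case=> s [t [s_bound t_bound /embed_combE[eq1 eq2]]].
have := unit_vec_det neq_ed neq_ed3.
set u := unit_vec d in eq1 eq2 *; set w := unit_vec e in eq1 eq2 *.
set det := _ - _ => det2.
(* Cramer's rule, where [det] is its own inverse. *)
pose i := det * ((v.1 - p.1) * w.2 - (v.2 - p.2) * w.1).
pose j := det * ((v.2 - p.2) * u.1 - (v.1 - p.1) * u.2).
have det2R : (det%:~R : R) ^+ 2 = 1 by rewrite -rmorphXn det2.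
have detE : det%:~R = u.1%:~R * w.2%:~R - u.2%:~R * w.1%:~R :> R.
  by rewrite /det; ring.
have iE : i%:~R = s :> R.
  have -> : i%:~R = det%:~R * ((v.1%:~R - p.1%:~R) * w.2%:~R
      - (v.2%:~R - p.2%:~R) * w.1%:~R) :> R by rewrite /i; ring.
  by rewrite eq1 eq2 -[RHS]mul1r -[X in _ = X * _]det2R !detE; ring.
have jE : j%:~R = t :> R.
  have -> : j%:~R = det%:~R * ((v.2%:~R - p.2%:~R) * u.1%:~R
      - (v.1%:~R - p.1%:~R) * u.2%:~R) :> R by rewrite /j; ring.
  by rewrite eq1 eq2 -[RHS]mul1r -[X in _ = X * _]det2R !detE; ring.
have {}s_bound : 0 <= i <= m%:Z.
  by move: s_bound; rewrite -iE -(ler_int R 0) -(ler_int R i) -pmulrn.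
have {}t_bound : 0 <= j <= n%:Z.
  by move: t_bound; rewrite -jE -(ler_int R 0) -(ler_int R j) -pmulrn.
exists `|i|%N, `|j|%N; split.
- by move: s_bound; clear; lia.
- by move: t_bound; clear; lia.
rewrite !gez0_abs; [|by case/andP: t_bound|by case/andP: s_bound].
apply: (@embed_inj R); rewrite -[RHS]addr0 -[_ + 0]addr0.
have -> : embed R (grid_pt p d e i j) = embed R p + s *: embed R u + t *: embed R w.
  by apply/embed_combE; rewrite grid_ptE -iE -jE !(rmorphM, rmorphD) /=; split; ring.
by rewrite !addr0; apply/embed_combE.
Qed.

Lemma forms_parallelogramE (R : realType) (S : {fset node}) :
  forms_parallelogram R S <-> exists (p : node) (d e : 'I_6) (m n : nat),
    [/\ e != d, e != d + 3 & forall v : node, v \in S <-> exists i j : nat,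
      [/\ (i <= m)%N, (j <= n)%N & v = grid_pt p d e i j]].
Proof.
split=> -[p [d [e [m [n [ed ed3 eqS]]]]]]; exists p, d, e, m, n; split=> //.
  move=> v; rewrite -(parallelogram_embed R p m n v ed ed3).
  have /(congr1 (fun A : set 'rV[R]_2 => A (embed R v))) /= := eqS.
  move=> eqv; split=> [Sv|Pv].
    have : (embed R @` [set` S])%classic (embed R v) by exists v.
    by rewrite -eqS => -[].
  have : (embed R @` [set` S])%classic (embed R v) by rewrite -eqS; split=> //; exists v.
  by case=> w Sw /embed_inj <-.
apply/seteqP; split=> x.
  case=> + [v _ xE]; rewrite -xE => /(parallelogram_embed R p m n v ed ed3).1 /eqS Sv.
  by exists v.
case=> v /= /eqS Sv <-; split; last by exists v.
exact/(parallelogram_embed R p m n v ed ed3).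
Qed.

Lemma lattice_forms (R : realType) (S : {fset node}) :
  lattice_parallelogram S <-> forms_parallelogram R S.
Proof.
rewrite forms_parallelogramE; split.
  case=> p [l [m [n memS]]]; exists p, l, (l + 1), m, n; split.
  - by clear; case_ord l.
  - by clear; case_ord l.
  - by move=> v; rewrite memS /pt /grid_pt /frame addr0.
case=> p [d [e [m [n [ed ed3 memS]]]]].
have : [|| e == d + 1, e == d + 2, d == e + 1 | d == e + 2].
  by move: ed ed3; clear; case_ord d; case_ord e.
case/or4P=> /eqP dE.
- exists p, d, m, n => v; rewrite memS dE /pt /grid_pt /frame addr0.
  by [].
(* Sides at 120 degrees: from the corner at the far end along [d], the directions [e] and [e + 1],
   opposite to [d], make 60 degrees. *)
- exists (grid_pt p d e m 0), e, n, m => v.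
  have ptE' x y : grid_pt p d e x y = pt (grid_pt p d e m 0) e true y (m%:Z - x).
    have opp : unit_vec (e + 1) = - unit_vec d.
      by rewrite dE; clear; case_ord d; vm_compute.
    by rewrite ptE !grid_ptE /frame addr0 opp; congr pair => /=; ring.
  rewrite memS; split=> -[i [j [le_i le_j ->]]].
    exists j, (m - i)%N; rewrite leq_subr; split=> //.
    by rewrite ptE' -subzn.
  exists (m - j)%N, i; rewrite leq_subr; split=> //.
  by rewrite [RHS]ptE'; congr pt; move: le_j; clear; lia.
- exists p, e, n, m => v; rewrite memS dE; split.
    case=> i [j [? ? ->]]; exists j, i; split=> //.
    by rewrite /pt /grid_pt /frame addr0 addrAC.
  case=> i [j [? ? ->]]; exists j, i; split=> //.
  by rewrite /pt /grid_pt /frame addr0 addrAC.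
exists (grid_pt p d e 0 n), d, m, n => v.
have ptE' x y : grid_pt p d e x y = pt (grid_pt p d e 0 n) d true x (n%:Z - y).
  have opp : unit_vec (d + 1) = - unit_vec e.
    by rewrite dE; clear; case_ord e; vm_compute.
  by rewrite ptE !grid_ptE /frame addr0 opp; congr pair => /=; ring.
rewrite memS; split=> -[i [j [le_i le_j ->]]].
  exists i, (n - j)%N; rewrite leq_subr; split=> //.
  by rewrite ptE' -subzn.
exists i, (n - j)%N; rewrite leq_subr; split=> //.
by rewrite [RHS]ptE'; congr pt; move: le_j; clear; lia.
Qed.

(** * Circuits along lines and the global circuit *)

Lemma ord6_addK (d : 'I_6) : d + 3 + 3 = d.
Proof. by case_ord d; apply: val_inj. Qed.

Lemma unit_vec_opp d : unit_vec (d + 3) = - unit_vec d.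
Proof. by case_ord d; vm_compute. Qed.

Lemma unit_vec_inj : injective unit_vec.
Proof. by move=> d e; case_ord d; case_ord e => // _; apply: val_inj. Qed.

Lemma frame_opp c b l : frame c b (l + 3) = frame c b l + 3.
Proof.
rewrite /frame; case: b; first by rewrite addrA.
by rewrite opprD addrA; congr (_ + _); apply: val_inj.
Qed.

Lemma frame_surj c b d : exists l, frame c b l = d.
Proof.
case: b; first by exists (d - c); rewrite /frame addrC subrK.
by exists (c - d); rewrite /frame opprB addrC subrK.
Qed.

Definition edge (x y : node) : {fset node} := [fset x; y]%fset.

Lemma edge_eq (x y u w : node) : u != 0 ->
  edge x (x + u) = edge y (y + w) ->
  (x = y /\ u = w) \/ (x = y + w /\ u = - w).
Proof.
move=> u_neq0 eq_e.
have : x \in edge y (y + w) by rewrite -eq_e /edge !inE eqxx.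
have : x + u \in edge y (y + w) by rewrite -eq_e /edge !inE eqxx orbT.
rewrite /edge !inE => e2 /orP[]/eqP xE; [left|right]; split=> //; move: e2.
  rewrite xE => /orP[]/eqP; last exact: addrI.
  by move/eqP; rewrite -[X in _ == X]addr0 (inj_eq (addrI _)) (negPf u_neq0).
rewrite xE -addrA => /orP[/eqP|].
  by rewrite -[RHS]addr0 => /addrI/eqP; rewrite addrC addr_eq0 => /eqP.
by rewrite (inj_eq (addrI _)) -[X in _ == X]addr0 (inj_eq (addrI _)) (negPf u_neq0).
Qed.

Lemma line0 v d : line v d 0 = v.
Proof. by rewrite /line mulr0z addr0. Qed.

Lemma lineS v d z : line v d (z + 1) = line v d z + unit_vec d.
Proof. by rewrite /line mulrzDr mulr1z addrA. Qed.

Lemma lineB v d z : line v d (z - 1) = line v d z - unit_vec d.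
Proof. by rewrite /line mulrzBr mulr1z addrA. Qed.

(** Adding 3 to a label reverses the direction for either chirality, so these wires follow grid
    lines. *)
Definition straight (k : nat) : {set lpin k * lpin k} :=
  [set w | w.2 == (w.1.1 + 3, w.1.2)].

Section Circuits.

Variables (k : nat) (A : protocol k) (S : {fset node}).
Variables (compass : S -> 'I_6) (chirality : S -> bool).
Variable c : config A S.

Local Notation dir := (dir_of_label compass chirality).
Local Notation pin_at := (pin_at (k := k) compass chirality).
Local Notation pins := (pins k compass chirality).
Local Notation wired := (wired compass chirality c).
Local Notation received := (received compass chirality c).

Lemma dirE a l : dir a l = frame (compass a) (chirality a) l.
Proof. by []. Qed.

Lemma pin_atE a l i :
  pin_at a (l, i) = (edge (val a) (val a + unit_vec (dir a l)), i).
Proof. by []. Qed.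

Lemma pin_at_pins a x : pin_at a x \in pins.
Proof. exact: in_imfset2. Qed.

(** Invariant along a path of wires: edge [z] joins points [z] and [z + 1] of the line, and all
    points from [a] to its nearer end are occupied. That end is [z] if [0 <= z] and [z + 1]
    otherwise, whence the two ranges. *)
Lemma line_circuit (a : S) (d : 'I_6) (i : 'I_k) (p q : pins) :
  (forall b, wires (c b) = straight k) ->
  val p = (edge (val a) (val a + unit_vec d), i) ->
  same_circuit c p q ->
  exists z : int, [/\
    val q = (edge (line (val a) d z) (line (val a) d (z + 1)), i),
    (forall t : int, 0 <= t <= z -> line (val a) d t \in S)
  & (forall t : int, z < t <= 0 -> line (val a) d t \in S)].
Proof.
move=> lines p_a /connectP[s pth ->] {q}.
have : exists z : int, [/\
    val p = (edge (line (val a) d z) (line (val a) d (z + 1)), i),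
    (forall t : int, 0 <= t <= z -> line (val a) d t \in S)
  & (forall t : int, z < t <= 0 -> line (val a) d t \in S)].
  exists 0; rewrite lineS line0; split=> // t t0; last lia.
  by rewrite (_ : t = 0) ?line0 ?(valP a) //; lia.
elim: s p {p_a} pth => [|q s IHs] p //= /andP[pq pth] inv; apply: IHs pth _.
have {inv}[z [pE le_z gt_z]] := inv.
have {pq}[b [l [j [p_b q_b]]]] : exists b l j,
    val p = pin_at b (l, j) /\ val q = pin_at b (l + 3, j).
  case/existsP: pq => b /existsP[[[l j] [l' j']]] /andP[].
  rewrite lines inE /= => /eqP[-> ->] /orP[]/andP[/eqP pE' /eqP qE'].
    by exists b, l, j.
  by exists b, (l + 3), j; rewrite ord6_addK.
have eq_p := etrans (esym pE) p_b.
have jE : j = i by have := congr1 snd eq_p.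
have := congr1 fst eq_p; rewrite lineS /= => /edge_eq.
(* Either [b] is point [z] and its wire leads to edge [z - 1], or it is point [z + 1] and the wire
   leads to edge [z + 1]. *)
case=> [|[bE dE]|[bE dE]]; first exact: unit_vec_neq0.
  have {}dE : d = dir b l by apply: unit_vec_inj.
  exists (z - 1); rewrite q_b jE pin_atE subrK dirE frame_opp -dirE -dE unit_vec_opp.
  rewrite lineB bE /edge fsetUC; split=> // t t_z; first by apply: le_z; lia.
  have [->|t_neq_z] := eqVneq t z; first by rewrite bE; apply: valP.
  by apply: gt_z; lia.
have {}bE : line (val a) d (z + 1) = val b by rewrite lineS bE dE addrK.
have {}dE : d + 3 = dir b l.
  by apply: unit_vec_inj; rewrite unit_vec_opp dE opprK.
exists (z + 1); rewrite q_b jE pin_atE dirE frame_opp -dirE -dE ord6_addK.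
rewrite (lineS _ _ (z + 1)) bE; split=> // t t_z; last by apply: gt_z; lia.
have [->|t_neq_z] := eqVneq t (z + 1); first by rewrite bE; apply: valP.
by apply: le_z; lia.
Qed.

Lemma line_received_sound (a : S) l (i : 'I_k) :
  (forall b, wires (c b) = straight k) -> (l, i) \in received a ->
  exists (b : S) (z : int), [/\ val b = line (val a) (dir a l) z,
    (forall t : int, (0 <= t <= z) || (z <= t <= 0) -> line (val a) (dir a l) t \in S)
    & beeps (c b) != set0].
Proof.
move=> lines; rewrite inE => /andP[_ /existsP[p /existsP[q /and3P[/eqP pE pq]]]].
case/existsP=> b /existsP[[l' j] /andP[beep_b /andP[bond_b /eqP qE]]].
have [z [qE' le_z gt_z]] := line_circuit lines pE pq.
have beeps_b : beeps (c b) != set0 by apply/set0Pn; exists (l', j).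
have := congr1 fst (etrans (esym qE') qE); rewrite lineS /= => /edge_eq.
case=> [|[bE dE]|[bE dE]]; first exact: unit_vec_neq0.
  exists b, z; split=> // t /orP[|t_z]; first exact: le_z.
  have [->|t_neq_z] := eqVneq t z; first by rewrite bE; apply: valP.
  by apply: gt_z; lia.
have line_z : line (val a) (dir a l) z \in S.
  by move: bond_b; rewrite /on_bond inE /neighbor_node bE.
exists b, (z + 1); split=> //; first by rewrite lineS bE dE addrK.
move=> t /orP[t_z|t_z].
  have [->|t_neq_z] := eqVneq t (z + 1); last by apply: le_z; lia.
  by rewrite lineS bE dE addrK; apply: valP.
by apply: gt_z; lia.
Qed.
Lemma line_received_complete (a b : S) l (i : 'I_k) (r : nat) :
  (forall b, wires (c b) = straight k) -> (0 < r)%N ->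
  (forall s : nat, (s <= r)%N -> line (val a) (dir a l) s \in S) ->
  val b = line (val a) (dir a l) r -> beeps (c b) = setT ->
  (l, i) \in received a.
Proof.
move=> lines r_gt0 run bE beep_b; set d := dir a l in run bE.
have bond_a : on_bond compass chirality a (l, i).
  rewrite /on_bond inE; have := run 1 r_gt0.
  by rewrite (lineS _ _ 0) line0.
pose p : pins := [` pin_at_pins a (l, i)]%fset.
have pinE (x : S) (s : nat) : val x = line (val a) d s ->
    exists l', dir x l' = d /\
      val x + unit_vec (dir x l') = line (val a) d s.+1.
  move=> xE; have [l' dirl'] := frame_surj (compass x) (chirality x) d.
  by exists l'; rewrite dirE dirl' xE -lineS intS addrC.
have chain (s : nat) : (s < r)%N -> exists q : pins,
    same_circuit c p q /\ val q = (edge (line (val a) d s) (line (val a) d s.+1), i).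
  elim: s => [|s IHs] lt_sr.
    by exists p; split; [exact: connect0|rewrite line0 (lineS _ _ 0) line0].
  have [q [pq qE]] := IHs (ltnW lt_sr).
  pose x : S := [` run _ (ltnW lt_sr)]%fset.
  have [l' [dirl' nbr]] := pinE x s.+1 erefl.
  exists [` pin_at_pins x (l', i)]%fset; split; last by rewrite /= pin_atE nbr.
  apply: connect_trans pq (connect1 _); apply/existsP; exists x.
  apply/existsP; exists ((l' + 3, i), (l', i)); rewrite lines inE /=.
  rewrite ord6_addK eqxx andTb; apply/orP; left; rewrite eqxx andbT; apply/eqP.
  rewrite [LHS]qE pin_atE dirE frame_opp -dirE dirl' unit_vec_opp /= /edge fsetUC.
  by rewrite (_ : s.+1 = s%:Z + 1 :> int) ?lineS ?addrK //; lia.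
have [q [pq qE]] := chain r.-1 ltac:(by rewrite prednK).
rewrite inE bond_a; apply/existsP; exists p; apply/existsP; exists q.
rewrite pq eqxx; apply/existsP; exists b.
have [l' dirl'] := frame_surj (compass b) (chirality b) (d + 3).
have nbr : neighbor_node compass chirality b l' = line (val a) d r.-1.
  rewrite /neighbor_node dirE dirl' bE unit_vec_opp -lineB; congr line.
  by move: r_gt0; clear; lia.
apply/existsP; exists (l', i); rewrite beep_b inE /on_bond inE /= nbr.
rewrite run ?leq_pred //=; apply/eqP; rewrite [LHS]qE /pin_at nbr prednK //= -bE.
by rewrite /edge fsetUC.
Qed.

(** A line circuit extends both ways; with nothing behind [a], and [a] itself silent, a beep can
    only come from ahead. *)
Lemma received_sees (ty : ('I_6 -> bool) -> bool) (a : S) l (i : 'I_k) :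
  (forall b, wires (c b) = straight k) ->
  (forall b, beeps (c b) = if ty (occ S (val b)) then setT else set0) ->
  ~~ ty (occ S (val a)) -> ~~ occ S (val a) (dir a l + 3) ->
  (l, i) \in received a <-> sees ty S (val a) (dir a l).
Proof.
move=> lines tys tya end_a; split=> [rec|[r [r_gt0 run tyr]]]; last first.
  pose b : S := [` run r (leqnn r)]%fset.
  have beep_b : beeps (c b) = setT by rewrite tys tyr.
  exact: (@line_received_complete a b l i r lines r_gt0 run erefl beep_b).
have [b [z [bE run beep_b]]] := line_received_sound lines rec.
have ty_b : ty (occ S (val b)) by move: beep_b; rewrite tys; case: ifP => //; rewrite eqxx.
have z_gt0 : 0 < z.
  case: (ltrgtP 0 z) => // [z_lt0|z0]; last first.
    by move: tya ty_b; rewrite bE -z0 line0 => /negPf->.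
  have := run (-1); rewrite (_ : -1 = 0 - 1) // lineB line0 -unit_vec_opp.
  rewrite -/(occ _ _ _) (negPf end_a); move: z_lt0; clear; lia.
exists `|z|%N; split.
- by move: z_gt0; clear; lia.
- by move=> s le_sz; apply: run; move: z_gt0 le_sz; clear; lia.
by rewrite gez0_abs ?ltW // -bE.
Qed.

(** With all wires present, the pins of each amoebot are joined, and shared bonds link neighbors
    into one circuit. As [a != b], connectedness gives both amoebots a bond. *)
Lemma received_all (a b : S) :
  (0 < k)%N -> connected_structure S -> (forall b, wires (c b) = setT) ->
  beeps (c b) = setT -> a != b -> received a != set0.
Proof.
move=> k_gt0 connS all_wires beep_b neq_ab; pose i : 'I_k := Ordinal k_gt0.
have step (x y : S) : adjacent (val x) (val y) ->
    exists l l', [/\ on_bond compass chirality x (l, i),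
      on_bond compass chirality y (l', i) & pin_at x (l, i) = pin_at y (l', i)].
  case/existsP=> d /eqP yE; have [l lE] := frame_surj (compass x) (chirality x) d.
  have [l' lE'] := frame_surj (compass y) (chirality y) (d + 3).
  have xl : neighbor_node compass chirality x l = val y.
    by rewrite /neighbor_node dirE lE yE.
  have yl' : neighbor_node compass chirality y l' = val x.
    by rewrite /neighbor_node dirE lE' unit_vec_opp yE addrK.
  exists l, l'; split; rewrite /on_bond ?inE /= ?xl ?yl' ?(valP x) ?(valP y) //.
  by rewrite /pin_at /= xl yl' fsetUC.
have same_node (x : S) u v : same_circuit c [` pin_at_pins x u]%fset [` pin_at_pins x v]%fset.
  apply: connect1; apply/existsP; exists x; apply/existsP; exists (u, v).
  by rewrite all_wires inE !eqxx.
have conn (x y : S) u v : same_circuit c [` pin_at_pins x u]%fset [` pin_at_pins y v]%fset.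
  have /connectP[s pth ->] := connS x y.
  elim: s x u pth => [|z s IHs] x u /=; first by move=> _; apply: same_node.
  case/andP=> /step[l [l' [_ _ pin_eq]]] /IHs path_z.
  apply: connect_trans (same_node x u (l, i)) _.
  have -> : [` pin_at_pins x (l, i)]%fset = [` pin_at_pins z (l', i)]%fset.
    exact: val_inj.
  exact: path_z.
have bond (x y : S) : x != y -> exists l, on_bond compass chirality x (l, i).
  have /connectP[[|z s] /= pth ->] := connS x y; first by rewrite eqxx.
  by case/andP: pth => /step[l [_ [? _ _]]] _ _; exists l.
have [l bond_a] := bond a b neq_ab.
have [l' bond_b] : exists l', on_bond compass chirality b (l', i).
  by apply: (bond b a); rewrite eq_sym.
apply/set0Pn; exists (l, i); rewrite inE bond_a /=.
apply/existsP; exists [` pin_at_pins a (l, i)]%fset.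
apply/existsP; exists [` pin_at_pins b (l', i)]%fset.
rewrite eqxx conn /=; apply/existsP; exists b; apply/existsP; exists (l', i).
by rewrite beep_b inE bond_b eqxx.
Qed.

Lemma received_none (a : S) : (forall b, beeps (c b) = set0) -> received a = set0.
Proof.
move=> no_beep; apply/setP => x; rewrite !inE; apply/negbTE/negP => /andP[_].
case/existsP=> p /existsP[q /and3P[_ _ /existsP[b /existsP[y]]]].
by rewrite no_beep inE.
Qed.

End Circuits.

(** * The protocol and its correctness *)

Definition hears (k : nat) (i : 'I_k) (o : 'I_6 -> bool) (r : {set lpin k}) : bool :=
  [forall l, boundary o l ==> ((l, i) \in r)].

(* Only the pins in position [i] are listened to.  The first component of the
   memory counts the rounds. *)
Definition detector (k : nat) (i : 'I_k) : protocol k :=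
  @Protocol k ('I_5 * bool)%type 0 (ord0, true)
    (fun nbrs m r _ =>
      let o := fun l => l \in nbrs in
      match nat_of_ord m.1 with
      | 0 => (@Ordinal 5 1 isT, fine o, straight k, if acute o then setT else set0)
      | 1 => (@Ordinal 5 2 isT, m.2 && (obtuse o ==> hears i o r), straight k,
              if obtuse o then setT else set0)
      | 2 => let ok := m.2 && (acute o ==> hears i o r) in
             (@Ordinal 5 3 isT, ok, setT, if ok then set0 else setT)
      | 3 => (@Ordinal 5 4 isT, m.2 && (r == set0), set0, set0)
      | _ => (m, set0, set0)
      end)
    (fun m => if nat_of_ord m.1 == 4 then Some m.2 else None).

(** Provides the empty node behind a corner that [received_sees] asks for. *)
Lemma corner_end o d : acute o || obtuse o -> boundary o d -> ~~ o (d + 3).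
Proof. by case_pattern o; case_ord d; vm_compute. Qed.

Section Correctness.

Variables (k : nat) (i : 'I_k) (S : {fset node}).
Variables (compass : S -> 'I_6) (chirality : S -> bool).
Variable flips : nat -> S -> (nflips (detector i)).-tuple bool.

Local Notation conf := (run compass chirality flips).
Local Notation received := (received compass chirality).

Let o (a : S) := occ S (val a).
Let labels (a : S) : 'I_6 -> bool := fun l => l \in occupied compass chirality a.

Let labelsE a : labels a = o a \o frame (compass a) (chirality a).
Proof. by apply: funext => l; rewrite /labels inE. Qed.

Definition ok_after2 (a : S) : bool :=
  fine (o a) && (obtuse (o a) ==> hears i (labels a) (received (conf 1) a)).

Definition ok_after3 (a : S) : bool :=
  ok_after2 a && (acute (o a) ==> hears i (labels a) (received (conf 2) a)).

Lemma conf1 a : conf 1 a = @AmoebotState k (detector i) (@Ordinal 5 1 isT, fine (o a))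
  (straight k) (if acute (o a) then setT else set0).
Proof.
by rewrite /= /next_config /= -/(labels a) labelsE fine_frame acute_frame.
Qed.

Lemma conf2 a : conf 2 a = @AmoebotState k (detector i) (@Ordinal 5 2 isT, ok_after2 a)
  (straight k) (if obtuse (o a) then setT else set0).
Proof.
rewrite [conf 2]/(next_config _ _ _ (conf 1)) /next_config conf1.
by rewrite /= -/(labels a) /ok_after2 labelsE obtuse_frame.
Qed.

Lemma conf3 a : conf 3 a = @AmoebotState k (detector i) (@Ordinal 5 3 isT, ok_after3 a)
  setT (if ok_after3 a then set0 else setT).
Proof.
rewrite [conf 3]/(next_config _ _ _ (conf 2)) /next_config conf2.
by rewrite /= -/(labels a) /ok_after3 labelsE acute_frame.
Qed.

(** After the fourth round the memory is frozen, so the output never changes. *)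
Lemma conf4 (t : nat) a : memo (conf (4 + t) a) =
  (@Ordinal 5 4 isT, ok_after3 a && (received (conf 3) a == set0)).
Proof.
elim: t => [|t IHt].
  by rewrite [conf 4]/(next_config _ _ _ (conf 3)) /next_config conf3.
by rewrite addnS [conf _.+1]/(next_config _ _ _ (conf (4 + t))) /next_config IHt.
Qed.

Lemma hears_sees ty (c : config (detector i) S) a :
  (forall b, wires (c b) = straight k) ->
  (forall b, beeps (c b) = if ty (o b) then setT else set0) ->
  ~~ ty (o a) -> acute (o a) || obtuse (o a) ->
  hears i (labels a) (received c a) <->
  forall d, boundary (o a) d -> sees ty S (val a) d.
Proof.
move=> lines tys tya corner; split=> [/forallP hear d bd|see].
  have [l lE] := frame_surj (compass a) (chirality a) d.
  have := hear l; rewrite labelsE boundary_frame lE bd /= => rec.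
  have := @received_sees _ _ _ compass chirality c ty a l i lines tys tya.
  by rewrite dirE lE => /(_ (corner_end corner bd)) [/(_ rec)].
apply/forallP => l; apply/implyP; rewrite labelsE boundary_frame => bd.
apply/(received_sees i lines tys tya); rewrite dirE; last exact: see.
exact: corner_end corner bd.
Qed.

Lemma ok_certified : (forall a, ok_after3 a) <-> certified S.
Proof.
have iff1 a : obtuse (o a) -> hears i (labels a) (received (conf 1) a) <->
    forall d, boundary (o a) d -> sees acute S (val a) d.
  move=> obt; apply: hears_sees.
  - by move=> b; rewrite conf1.
  - by move=> b; rewrite conf1.
  - by rewrite -acute_or_obtuse obt ?orbT.
  - by rewrite obt orbT.
have iff2 a : acute (o a) -> hears i (labels a) (received (conf 2) a) <->
    forall d, boundary (o a) d -> sees obtuse S (val a) d.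
  move=> acu; apply: hears_sees.
  - by move=> b; rewrite conf2.
  - by move=> b; rewrite conf2.
  - by rewrite acute_or_obtuse acu.
  - by rewrite acu.
split=> [ok v Sv|cert a].
  have /andP[/andP[fine_v /implyP obt] /implyP acu] := ok [` Sv]%fset.
  by split=> // [/[dup] obt_v /obt /iff1|/[dup] acu_v /acu /iff2]; apply.
have [fine_a obt acu] := cert (val a) (valP a).
rewrite /ok_after3 /ok_after2 fine_a /=; apply/andP; split; apply/implyP.
  by move=> obt_a; apply/iff1 => //; apply: obt.
by move=> acu_a; apply/iff2 => //; apply: acu.
Qed.

(** A failed amoebot other than [a] breaks the silence on the global circuit; a failure of [a]
    itself is recorded in [ok_after3 a]. *)
Lemma outcome a : connected_structure S ->
  ok_after3 a && (received (conf 3) a == set0) <-> forall b, ok_after3 b.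
Proof.
move=> connS; split=> [/andP[ok_a /eqP silent] b|ok].
  apply/negPn/negP => bad_b.
  have neq_ab : a != b by apply: contraNneq bad_b => <-.
  have k_gt0 : (0 < k)%N by apply: leq_ltn_trans (ltn_ord i).
  have := @received_all _ _ _ compass chirality (conf 3) a b k_gt0 connS.
  rewrite silent eqxx; move/(_ (fun b => congr1 (@wires _ _) (conf3 b))).
  by rewrite conf3 (negPf bad_b) => /(_ erefl neq_ab).
rewrite ok; apply/eqP; apply: received_none => b.
by rewrite conf3 ok.
Qed.

End Correctness.

Theorem lemmaD1 (R : realType) (k : nat) (hk : (0 < k)%N) :
  exists (A : protocol k) (T : nat),
    decides_within A T (forms_parallelogram R).
Proof.
exists (detector (Ordinal hk)), 4 => S connS compass chirality flips a t.
(* Before round 4 the counter in memory is below 4 and there is no output. *)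
case: (ltnP t 4) => [|/subnKC <-].
  case: t => [|[|[|[|//]]]] _; cbv zeta.
  - by split.
  - by rewrite conf1; split.
  - by rewrite conf2; split.
  - by rewrite conf3; split.
rewrite conf4 /=; split=> // b [<-].
have -> : forms_parallelogram R S <-> certified S.
  rewrite -lattice_forms; split; first exact: lattice_certified.
  by apply: certified_lattice => //; exists (val a); apply: valP.
rewrite -(ok_certified compass chirality flips).
exact: outcome.
Qed.
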